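(* Let $d,n\ge 1$ be integers, $N=2n+2$, and let $A^D\in\mathbb{R}^{n^d\times n^d}$, $A^P\in\mathbb{R}^{N^d\times N^d}$, $E_d=E^{\otimes d}$, $R_d=R^{\otimes d}$ be the matrices defined in the context. Assume that $A^P$ is invertible. Then the inverse of $A^D$ can be written as $$(A^D)^{-1}=R_d\,(A^P)^{-1}E_d ,$$ or equivalently, for every $\bm f\in\mathbb{C}^{n^d}$ the solution $\bm u$ of $A^D\bm u=\bm f$ is $\bm u=R_d(A^P)^{-1}E_d\bm f$.
   Context: Let $d,n\ge1$ be integers, $k\in\mathbb{R}$ a constant, $h=1/(n+1)$, $N=2n+2$. For a matrix $M$, $M^{\otimes p}=M\otimes\cdots\otimes M$ ($p$ copies; the factor is omitted when $p=0$), where $\otimes$ is the Kronecker product. $T^D\in\mathbb{R}^{n\times n}$ is the tridiagonal matrix with $2$ on the diagonal and $-1$ on the sub- and superdiagonal. $T^P\in\mathbb{R}^{N\times N}$ is the circulant matrix $T^P=\operatorname{tridiag}(-1,2,-1)-e_1e_N^t-e_Ne_1^t$, where $e_1,\dots,e_N$ is the standard basis of $\mathbb{R}^N$. The discrete Dirichlet Helmholtz matrix on $(0,1)^d$ is $$A^D=\sum_{j=1}^d I_n^{\otimes(j-1)}\otimes T^D\otimes I_n^{\otimes(d-j)}-k^2h^2 I_n^{\otimes d}\in\mathbb{R}^{n^d\times n^d},$$ and the discrete periodic Helmholtz matrix is $$A^P=\sum_{j=1}^d I_N^{\otimes(j-1)}\otimes T^P\otimes I_N^{\otimes(d-j)}-k^2h^2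 I_N^{\otimes d}\in\mathbb{R}^{N^d\times N^d}.$$ The (odd) extension $E:\mathbb{C}^n\to\mathbb{C}^N$ is $(E\bm f)_j=f_j$ for $1\le j\le n$, $(E\bm f)_{n+1}=0$, $(E\bm f)_j=-f_{N-j}$ for $n+2\le j\le 2n+1$, and $(E\bm f)_N=0$. The restriction $R:\mathbb{C}^N\to\mathbb{C}^n$ is $(R\bm v)_j=v_j$ for $1\le j\le n$, i.e. $R=(I_n\,|\,0)$. *)

(* Defs.v *)
From mathcomp Require Import all_boot all_order all_algebra.
From mathcomp Require Import reals.
From mathcomp Require Export complex mxtens.

Set Implicit Arguments.
Unset Strict Implicit.
Unset Printing Implicit Defensive.

Import Order.TTheory GRing.Theory Num.Theory.
Local Open Scope ring_scope.

(* The mathematical indices run from 1; index l there is the ordinal of value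
   l.-1 here. Kronecker products and powers are those of [mxtens]: [A *t B] is
   in the usual lexicographic order, and [A ^t 0] is the 1 x 1 identity, so that
   tensoring with it amounts, up to a cast, to omitting the factor. *)

Definition periodic_size (n : nat) : nat := (2 * n).+2.

Section Matrices.
Variable R : nzRingType.

Definition tridiag (m : nat) : 'M[R]_m :=
  \matrix_(i, j) if i == j then 2
                 else if (i.+1 == j :> nat) || (j.+1 == i :> nat) then -1
                 else 0.

Definition TD (n : nat) : 'M[R]_n := tridiag n.

Definition TP (n : nat) : 'M[R]_(periodic_size n) :=
  let e (i : 'I_(2 * n).+2) : 'cV[R]_(2 * n).+2 := delta_mx i 0 in
  tridiag (2 * n).+2 - e ord0 *m (e ord_max)^T - e ord_max *m (e ord0)^T.

Lemma kron_size (m d : nat) (j : 'I_d) :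
  (m ^ j * m * m ^ (d - j.+1))%N = (m ^ d)%N.
Proof. by rewrite -expnSr -expnD subnKC. Qed.

(* The ordinal j stands for j.+1 in the usual range 1 <= j <= d. *)
Definition kron_sum (m d : nat) (T : 'M[R]_m) : 'M[R]_(m ^ d) :=
  \sum_(j < d)
    castmx (kron_size m j, kron_size m j)
      ((1%:M : 'M[R]_m) ^t j *t T *t (1%:M : 'M[R]_m) ^t (d - j.+1)).

(* The component f_l for l >= 1 (1-based), with value 0 when l > n. *)
Definition component (n : nat) (f : 'cV[R]_n) (l : nat) : R :=
  if insub l.-1 is Some i then f i 0 else 0.

Definition odd_ext (n : nat) (f : 'cV[R]_n) : 'cV[R]_(periodic_size n) :=
  \col_j let l := (nat_of_ord j).+1 in
    if (l <= n)%N then component f l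
    else if l == n.+1 then 0
    else if (l <= 2 * n + 1)%N then - component f (periodic_size n - l)
    else 0.

(* The matrix of [odd_ext] in the standard bases. *)
Definition ext_mx (n : nat) : 'M[R]_(periodic_size n, n) :=
  \matrix_(i, j) odd_ext (delta_mx j 0 : 'cV[R]_n) i 0.

Lemma component_sum (n : nat) (f : 'cV[R]_n) (l : nat) :
  component f l = \sum_j component (delta_mx j 0 : 'cV[R]_n) l * f j 0.
Proof.
rewrite /component; case: insubP => [i _ _|_]; last first.
  by rewrite big1 // => j _; rewrite mul0r.
rewrite (bigD1 i) //= big1 ?addr0 => [|j nij].
  by rewrite mxE !eqxx mul1r.
by rewrite mxE eq_sym (negPf nij) mul0r.
Qed.

Lemma ext_mxE (n : nat) (f : 'cV[R]_n) : ext_mx n *m f = odd_ext f.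
Proof.
apply/matrixP => i j; rewrite {j}ord1 !mxE /=.
under eq_bigr => j _ do rewrite !mxE /=.
case: ifP => _; first by rewrite [RHS]component_sum.
case: ifP => _; first by rewrite big1 // => j _; rewrite mul0r.
case: ifP => _; last by rewrite big1 // => j _; rewrite mul0r.
by rewrite [in RHS]component_sum -sumrN; apply: eq_bigr => j _; rewrite mulNr.
Qed.

(* The block matrix (I_n | 0). *)
Definition restr_mx (n : nat) : 'M[R]_(n, periodic_size n) := pid_mx n.

Lemma periodic_size_ge (n : nat) : (n <= periodic_size n)%N.
Proof. by rewrite /periodic_size mul2n -addnn -!addnS leq_addr. Qed.

Lemma restr_mxE (n : nat) (v : 'cV[R]_(periodic_size n)) (i : 'I_n) :
  (restr_mx n *m v) i 0 = v (widen_ord (periodic_size_ge n) i) 0.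
Proof.
rewrite mxE (bigD1 (widen_ord (periodic_size_ge n) i)) //= big1 => [|j nij].
  by rewrite mxE /= eqxx ltn_ord mul1r addr0.
rewrite mxE; case: eqP => [eij|_]; last by rewrite mul0r.
by case/eqP: nij; apply: val_inj; rewrite /= -eij.
Qed.

End Matrices.

Section Helmholtz.
Variable R : realType.

Definition mesh_size (n : nat) : R := 1 / (n%:R + 1).

Definition AD (d n : nat) (k : R) : 'M[R]_(n ^ d) :=
  kron_sum d (TD R n)
  - (k ^+ 2 * mesh_size n ^+ 2) *: (1%:M : 'M[R]_n) ^t d.

Definition AP (d n : nat) (k : R) : 'M[R]_(periodic_size n ^ d) :=
  kron_sum d (TP R n)
  - (k ^+ 2 * mesh_size n ^+ 2) *: (1%:M : 'M[R]_(periodic_size n)) ^t d.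

Definition Ed (d n : nat) : 'M[R[i]]_(periodic_size n ^ d, n ^ d) :=
  ext_mx R[i] n ^t d.

Definition Rd (d n : nat) : 'M[R[i]]_(n ^ d, periodic_size n ^ d) :=
  restr_mx R[i] n ^t d.

Definition complexify (p q : nat) (A : 'M[R]_(p, q)) : 'M[R[i]]_(p, q) :=
  map_mx (real_complex R) A.

End Helmholtz.

(* Main.v *)
Require Import Defs.
From mathcomp Require Import all_boot all_order all_algebra.
From mathcomp Require Import reals.
From mathcomp Require Import zify ring.

(** The odd extension E intertwines the two one-dimensional stencils: a vector
    on the 2n+2 points of the periodic grid which is odd about the last point
    and about the point n+1 vanishes at both, so it is sent by the periodic
    stencil to a vector with the same symmetry, and on the first n points the
    missing neighbours of the Dirichlet stencil are these two zeros. Hence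
    T^P E = E T^D ([TP_ext_mx]), while R E = I because E copies its argument on
    the first n points ([restr_ext_mx]).

    Both identities pass to Kronecker powers. Each summand of A^P differs from
    an identity in one tensor factor only, and E^{(x)d} splits along the same
    three factors ([ntensmx_split]), so the mixed product rule moves
    E^{(x)d} across the summand ([kron_sum_intertwine]). The shift by k^2h^2 is
    the same multiple of the identity on both grids, which gives A^P E_d = E_d A^D
    ([AP_ext_tens]). Multiplying by R_d (A^P)^{-1} on the left yields
    R_d (A^P)^{-1} E_d A^D = R_d E_d = I, so A^D is invertible with the claimed
    inverse. All of this happens over the reals; the complex statement is its
    image under the embedding of the reals. *)

Set Implicit Arguments.
Unset Strict Implicit.
Unset Printing Implicit Defensive.

Import GRing.Theory.
Local Open Scope ring_scope.

(** * Kronecker powers *)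

Lemma castmx_mulmx (R : pzRingType) (m m' n n' p p' : nat)
    (em : m = m') (en : n = n') (ep : p = p')
    (A : 'M[R]_(m, n)) (B : 'M[R]_(n, p)) :
  castmx (em, en) A *m castmx (en, ep) B = castmx (em, ep) (A *m B).
Proof. by case: m' / em; case: n' / en; case: p' / ep. Qed.

Lemma tensmx_castl (R : pzRingType) (m m' n n' p q : nat)
    (em : m = m') (en : n = n') (A : 'M[R]_(m, n)) (B : 'M[R]_(p, q)) :
  castmx (em, en) A *t B
    = castmx (congr1 (muln^~ p) em, congr1 (muln^~ q) en) (A *t B).
Proof. by case: m' / em; case: n' / en. Qed.

Lemma tensmxA (R : pzRingType) (m n p q r s : nat)
    (A : 'M[R]_(m, n)) (B : 'M[R]_(p, q)) (C : 'M[R]_(r, s)) :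
  A *t (B *t C) = castmx (esym (mulnA _ _ _), esym (mulnA _ _ _)) (A *t B *t C).
Proof.
apply/matrixP => i j; rewrite castmxE !mxE mulrA.
congr (A _ _ * B _ _ * C _ _); apply: val_inj => /=.
- by rewrite -divnMA [(r * p)%N]mulnC.
- by rewrite -divnMA [(s * q)%N]mulnC.
- by rewrite modn_divl.
- by rewrite modn_divl.
- by rewrite modn_dvdm ?dvdn_mull.
- by rewrite modn_dvdm ?dvdn_mull.
Qed.

Lemma tens1mx (R : pzRingType) (m n : nat) :
  (1%:M : 'M[R]_m) *t (1%:M : 'M[R]_n) = 1%:M.
Proof.
apply/matrixP => i j.
case: (mxtens_indexP i) => i1 i2; case: (mxtens_indexP j) => j1 j2.
rewrite tensmxE !mxE (can_eq (@mxtens_indexK m n)) xpair_eqE.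
by rewrite -natrM mulnb.
Qed.

(** Powers unfold without a cast only from the second one on, since the first
    power is the matrix itself rather than its product with the 1 x 1 identity;
    the cast makes the recursion uniform. *)
Lemma ntensmx_succ (R : comPzRingType) (m n k : nat) (A : 'M[R]_(m, n)) :
  A ^t k.+1 = castmx (esym (expnS m k), esym (expnS n k)) (A *t A ^t k).
Proof.
case: k => [|k]; last by rewrite castmx_id.
by rewrite ntensmx0 tens_mx_scalar scale1r castmx_comp castmx_id.
Qed.

Lemma ntensmxD (R : comPzRingType) (m n j k : nat) (A : 'M[R]_(m, n))
    (em : (m ^ j * m ^ k)%N = (m ^ (j + k))%N)
    (en : (n ^ j * n ^ k)%N = (n ^ (j + k))%N) :
  castmx (em, en) (A ^t j *t A ^t k) = A ^t (j + k).
Proof.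
elim: j em en => [|j IHj] em en.
  by rewrite ntensmx0 tens_scalar1mx castmx_comp castmx_id.
rewrite [RHS](@ntensmx_succ _ _ _ (j + k) A).
rewrite -(IHj (esym (expnD m j k)) (esym (expnD n j k))).
rewrite [A ^t j.+1]ntensmx_succ tensmx_castl castmx_comp.
have -> : A *t castmx (esym (expnD m j k), esym (expnD n j k)) (A ^t j *t A ^t k)
  = castmx (congr1 (muln m) (esym (expnD m j k)),
            congr1 (muln n) (esym (expnD n j k))) (A *t (A ^t j *t A ^t k)).
  by case: _ / (esym (expnD m j k)); case: _ / (esym (expnD n j k)).
by rewrite tensmxA !castmx_comp; apply: eq_castmx.
Qed.

(** Puts a Kronecker power in the shape of the summands of a Kronecker sum, so
    that the two can be multiplied factor by factor. Quantifying over the size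
    equations lets the cast match the opaque ones carried by [kron_sum]. *)
Lemma ntensmx_split (R : comPzRingType) (m n d : nat) (j : 'I_d)
    (A : 'M[R]_(m, n))
    (em : (m ^ j * m * m ^ (d - j.+1))%N = (m ^ d)%N)
    (en : (n ^ j * n * n ^ (d - j.+1))%N = (n ^ d)%N) :
  castmx (em, en) (A ^t j *t A *t A ^t (d - j.+1)) = A ^t d.
Proof.
have ed : d = (j + 1 + (d - j.+1))%N by rewrite addn1 subnKC.
move: (nat_of_ord j) (d - j.+1)%N ed em en => a b -> em en {j d}.
have := ntensmxD A (esym (expnD m (a + 1) b)) (esym (expnD n (a + 1) b)).
rewrite -(ntensmxD A (esym (expnD m a 1)) (esym (expnD n a 1))).
rewrite ntensmx1 tensmx_castl castmx_comp => <-; exact: eq_castmx.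
Qed.

Lemma ntensmx_mul (R : comPzRingType) (m n p k : nat)
    (A : 'M[R]_(m, n)) (B : 'M[R]_(n, p)) :
  A ^t k *m B ^t k = (A *m B) ^t k.
Proof.
elim: k => [|k IHk]; first by rewrite !ntensmx0 mul1mx.
by rewrite !ntensmx_succ castmx_mulmx tensmx_mul IHk.
Qed.

Lemma ntens1mx (R : comPzRingType) (m k : nat) :
  (1%:M : 'M[R]_m) ^t k = 1%:M.
Proof.
elim: k => [|k IHk]; first by rewrite ntensmx0.
rewrite ntensmx_succ IHk tens1mx; by case: _ / (esym (expnS m k)).
Qed.

Lemma map_ntensmx (R S : comPzRingType) (f : {rmorphism R -> S})
    (m n k : nat) (A : 'M[R]_(m, n)) :
  map_mx f (A ^t k) = map_mx f A ^t k.
Proof.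
elim: k => [|k IHk]; first by rewrite !ntensmx0 map_mx1.
by rewrite !ntensmx_succ map_castmx map_mxT IHk.
Qed.

(** In the summand that carries T in position j, the mixed product rule only
    needs E to commute with identities in the other positions and T E = E S in
    position j. *)
Lemma kron_sum_intertwine (R : comNzRingType) (m n d : nat)
    (T : 'M[R]_m) (S : 'M[R]_n) (E : 'M[R]_(m, n)) :
  T *m E = E *m S -> kron_sum d T *m E ^t d = E ^t d *m kron_sum d S.
Proof.
move=> TE; rewrite /kron_sum mulmx_suml mulmx_sumr; apply: eq_bigr => j _.
rewrite -(ntensmx_split E (kron_size m j) (kron_size n j)).
by rewrite !castmx_mulmx !tensmx_mul TE !ntens1mx !mul1mx !mulmx1.
Qed.

(** * The odd extension in one dimension *)

(** The extension as a difference of indicators: with rows counted from 0, the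
    copy of f sits at i = j and its reflected negative at i = 2n - j. For j < n
    these positions differ, and neither of them is n or 2n+1, the two rows where
    the extension vanishes. *)
Lemma ext_mxE01 (R : nzRingType) (n : nat) (i : 'I_(periodic_size n))
    (j : 'I_n) :
  ext_mx R n i j = (i == j :> nat)%:R - (i + j == 2 * n)%N%:R.
Proof.
have compE l : component (delta_mx j 0 : 'cV[R]_n) l = (l.-1 == j)%:R.
  rewrite /component; case: insubP => [l' _ <-|].
    by rewrite mxE eqxx andbT.
  by have := ltn_ord j; case: eqP => //; lia.
have := ltn_ord j; have := ltn_ord i; rewrite !mxE /= !compE {compE}.
move: (nat_of_ord i) (nat_of_ord j) => {}i {}j.
rewrite /periodic_size => li lj.
case: ifP => [le|gt].
  have -> : (i + j == 2 * n)%N = false by lia.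
  by rewrite subr0.
have -> : (i == j :> nat) = false by lia.
rewrite sub0r; case: ifP => [mid|nmid].
  have -> : (i + j == 2 * n)%N = false by lia.
  by rewrite oppr0.
case: ifP => [low|high]; first by congr (- _%:R); lia.
have -> : (i + j == 2 * n)%N = false by lia.
by rewrite oppr0.
Qed.

Lemma restr_ext_mx (R : nzRingType) (n : nat) :
  restr_mx R n *m ext_mx R n = 1%:M.
Proof.
apply/matrixP => i j; have := ltn_ord i; have := ltn_ord j => lj li.
have := restr_mxE (col j (ext_mx R n)) i.
rewrite [in LHS]colE mulmxA -colE mxE => ->.
rewrite [LHS]mxE ext_mxE01 mxE -val_eqE /=.
have -> : (i + j == 2 * n)%N = false by lia.
by rewrite subr0.
Qed.

(** In this additive form, entries of products with E are compared by dropping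
    the indicators that vanish and cancelling the others as ring elements. *)
Lemma tridiagE01 (R : nzRingType) (m : nat) (i j : 'I_m) :
  tridiag R m i j = (i == j :> nat)%:R *+ 2
                    - (i.+1 == j :> nat)%:R - (j.+1 == i :> nat)%:R.
Proof.
rewrite mxE -val_eqE /=.
case: eqP => [->|_]; first by rewrite gtn_eqF // !subr0.
case: eqP => [<-|_] /=.
  have -> : (i.+2 == i :> nat) = false by lia.
  by rewrite mul0rn sub0r subr0.
by case: eqP => _; rewrite mul0rn !sub0r ?oppr0 ?addr0 ?add0r.
Qed.

Lemma TPE01 (R : nzRingType) (n : nat) (i j : 'I_(periodic_size n)) :
  TP R n i j = (i == j :> nat)%:R *+ 2
               - (i.+1 == j :> nat)%:R - (j.+1 == i :> nat)%:R
               - ((i == 0 :> nat) && (j == (2 * n).+1 :> nat))%:R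
               - ((i == (2 * n).+1 :> nat) && (j == 0 :> nat))%:R.
Proof.
rewrite /TP !trmx_delta !mul_delta_mx !mxE -tridiagE01 mxE.
by rewrite -!val_eqE.
Qed.

(** A column of E has two nonzero entries, so multiplying by E on the right
    subtracts two columns. *)
Lemma mulmx_ext (R : nzRingType) (p n : nat) (A : 'M[R]_(p, periodic_size n))
    (i : 'I_p) (j : 'I_n) (l l' : 'I_(periodic_size n)) :
  l = j :> nat -> (l' + j)%N = (2 * n)%N ->
  (A *m ext_mx R n) i j = A i l - A i l'.
Proof.
move=> el el'; rewrite mxE.
under eq_bigr => x _ do rewrite ext_mxE01 mulrBr !mulr_natr.
rewrite big_split /=; congr (_ + _).
  rewrite (bigD1 l) //= el eqxx mulr1n big1 ?addr0 // => x.
  by rewrite -val_eqE /= el => /negPf->.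
rewrite sumrN; congr (- _).
rewrite (bigD1 l') //= el' eqxx mulr1n big1 ?addr0 // => x.
rewrite -val_eqE /= => nx.
by have -> : (x + j == 2 * n)%N = false by lia.
Qed.

(** Replaces by [false] every indicator that the linear constraints on the
    indices in context refute. *)
Ltac zero_indicators := repeat match goal with
  |- context [nat_of_bool ?b] =>
    lazymatch b with false => fail | _ => have -> : b = false by lia end
  end.

(** Column j of E is e_j - e_(2n-j), and its image under the periodic stencil
    is compared with the odd extension of column j of T^D in the four ranges of
    rows that define the extension. On the first n rows e_(2n-j) is too far away
    to contribute, and so is e_j on the reflected rows; on the rows n and 2n+1,
    the two fixed points of the reflection, the two contributions cancel. *)
Lemma TP_ext_mx (R : comNzRingType) (n : nat) :
  TP R n *m ext_mx R n = ext_mx R n *m TD R n.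
Proof.
apply/matrixP => i j; have lj := ltn_ord j.
have li : (i < (2 * n).+2)%N := ltn_ord i.
have hl : (j < (2 * n).+2)%N by lia.
have hl' : (2 * n - j < (2 * n).+2)%N by lia.
rewrite (@mulmx_ext _ _ _ _ i j (Ordinal hl) (Ordinal hl')) //=; last by lia.
have -> : (ext_mx R n *m TD R n) i j = odd_ext (col j (TD R n)) i 0.
  by rewrite -ext_mxE [in RHS]colE mulmxA -colE [RHS]mxE.
have compE l : (l.-1 < n)%N -> component (col j (TD R n)) l
    = (l.-1 == j :> nat)%:R *+ 2 - (l.-1.+1 == j :> nat)%:R
      - (j.+1 == l.-1 :> nat)%:R.
  move=> lt; rewrite /component; case: insubP => [x _ <-|]; last by rewrite lt.
  by rewrite mxE tridiagE01.
rewrite !TPE01 mxE /= {hl hl'}; move: (nat_of_ord i) li => {}i li.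
rewrite /periodic_size; case: ifP => [low|nlow].
  by rewrite compE //=; zero_indicators; ring.
case: ifP => [mid|nmid].
  (* i = n, reached from both sides at once, when j = n - 1 *)
  zero_indicators; rewrite (_ : (j.+1 == i) = (i.+1 == 2 * n - j))%N; last lia.
  ring.
case: ifP => [high|last].
  rewrite compE /=; last by lia.
  (* The reflection i -> 2n - i exchanges the two off-diagonals. *)
  rewrite (_ : ((2 * n).+2 - i.+1).-1 = 2 * n - i)%N; last lia.
  rewrite (_ : (2 * n - i == j) = (i == 2 * n - j))%N; last lia.
  rewrite (_ : ((2 * n - i).+1 == j) = ((2 * n - j).+1 == i))%N; last lia.
  rewrite (_ : (j.+1 == 2 * n - i) = (i.+1 == 2 * n - j))%N; last lia.
  zero_indicators; ring.
(* i = 2n+1, where the corner entry of the circulant meets the reflected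
   off-diagonal, when j = 0 *)
rewrite (_ : (i == (2 * n).+1) && (j == 0 :> nat) = ((2 * n - j).+1 == i))%N;
  last lia.
zero_indicators; ring.
Qed.

(** * The intertwining in dimension d and the inverse *)

Lemma AP_ext_tens (R : realType) (d n : nat) (k : R) :
  AP d n k *m ext_mx R n ^t d = ext_mx R n ^t d *m AD d n k.
Proof.
rewrite /AP /AD mulmxBl mulmxBr (kron_sum_intertwine d (TP_ext_mx R n)).
by rewrite -scalemxAl -scalemxAr !ntens1mx mul1mx mulmx1.
Qed.

Lemma complexify_ext (R : realType) (d n : nat) :
  complexify (ext_mx R n ^t d) = Ed R d n.
Proof.
rewrite /complexify map_ntensmx /Ed; congr (_ ^t d).
by apply/matrixP => i j; rewrite mxE !ext_mxE01 rmorphB !rmorph_nat.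
Qed.

Lemma complexify_restr (R : realType) (d n : nat) :
  complexify (restr_mx R n ^t d) = Rd R d n.
Proof. by rewrite /complexify map_ntensmx map_pid_mx. Qed.

Theorem theorem1 (R : realType) (d n : nat) (k : R)
    (hd : (1 <= d)%N) (hn : (1 <= n)%N) (hAP : AP d n k \in unitmx) :
  [/\ AD d n k \in unitmx,
      complexify (invmx (AD d n k))
        = Rd R d n *m complexify (invmx (AP d n k)) *m Ed R d n
    & forall f u : 'cV[R[i]]_(n ^ d),
        complexify (AD d n k) *m u = f <->
        u = Rd R d n *m complexify (invmx (AP d n k)) *m Ed R d n *m f].
Proof.
pose B := restr_mx R n ^t d *m invmx (AP d n k) *m ext_mx R n ^t d.
have BA : B *m AD d n k = 1%:M.
  rewrite /B -mulmxA -AP_ext_tens mulmxA mulmxKV //.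
  by rewrite ntensmx_mul restr_ext_mx ntens1mx.
have [_ uA] := mulmx1_unit BA.
have cB : Rd R d n *m complexify (invmx (AP d n k)) *m Ed R d n = complexify B.
  by rewrite -complexify_restr -complexify_ext /complexify !map_mxM.
have iA : invmx (AD d n k) = B by rewrite -[LHS]mul1mx -BA mulmxK.
rewrite cB; split=> [//||f u]; first by rewrite iA.
have cBA : complexify B *m complexify (AD d n k) = 1%:M.
  by rewrite /complexify -map_mxM BA map_mx1.
split=> [<-|->]; first by rewrite mulmxA cBA mul1mx.
by rewrite mulmxA (mulmx1C cBA) mul1mx.
Qed.
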